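(* Let $I$ be a problem with agents $N$, contracts $E$, participant sets $P(e)$ and Plott choice functions $C_a$ on $E(a)$. Let $0\in N$ be an agent with $C_0=C_1*C_2$, where $C_1,C_2$ are Plott choice functions on $E(0)$, and let $\widetilde I$ be the modified problem with projection $\pi:\widetilde E\to E$ (both described in the context). Let $\widetilde S\subseteq\widetilde E$ be a stable set of $\widetilde I$ and $S=\pi(\widetilde S)$. Then the restriction $\pi:\widetilde S\to S$ is a bijection and $S$ is a stable set of $I$.
   Context: All sets are finite. A choice function (CF) on a set $X$ is a map $C:2^X\to 2^X$ with $C(A)\subseteq A$. It is a Plott CF if it is consistent ($C(A)\subseteq B\subseteq A\Rightarrow C(B)=C(A)$) and substitutable ($B\subseteq A\Rightarrow C(A)\cap B\subseteq C(B)$). For CFs $F,G$ on the same set, $(F*G)(A)=F(A)\cup G(A\setminus F(A))$. A problem consists of a finite set $N$ of agents, a finite set $E$ of contracts, for each $e\in E$ a set $P(e)\subseteq N$ of participants, and for each $a\in N$ a Plott CF $C_a$ on $E(a)=\{e\in E: a\in P(e)\}$. For $S\subseteq E$ write $S(a)=S\cap E(a)$. $S$ is stable if (1) $C_a(S(a))=S(a)$ for all $a\in N$, and (2) every $e\in E$ such that $e\in C_a(S(a)\cup\{e\})$ for all $a\in P(e)$ belongs to $S$. Modified problem $\widetilde I$: Let $M=N\setminus\{0\}$, $R=E\setminus E(0)$. Contracts: $\widetilde E=R\sqcup\{e_1: e\in E(0)\}\sqcup\{e_2:e\in E(0)\}$ (two disjoint copies of $E(0)$), with $\pi:\widetilde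 E\to E$ given by $\pi(r)=r$ for $r\in R$ and $\pi(e_i)=e$. Agents: $1,2$ and $\widetilde m$ for each $m\in M$. Participants: for $r\in R$, $\{\widetilde m: m\in P(r)\}$; for $e_i$, $\{i\}\cup\{\widetilde m: m\in P(e)\setminus\{0\}\}$. Thus $\widetilde E(i)=\{e_i:e\in E(0)\}$ and $\widetilde E(\widetilde m)=\pi^{-1}(E(m))$. The CF of agent $i\in\{1,2\}$ is $C_i$ transported via $\pi$: $\widetilde C_i(B)=\{e_i: e\in C_i(\pi(B))\}$. The CF of $\widetilde m$ is: for $B\subseteq\widetilde E(\widetilde m)$, $\widetilde C_{\widetilde m}(B)$ consists, for each $x\in C_m(\pi(B))$, of the single element $x$ if $x\in R$, and, if $x\in E(0)$, of $x_1$ when $x_1\in B$ and of $x_2$ otherwise (i.e. copy 1 is preferred to copy 2 within each fibre of $\pi$).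
   Formalization: The formal theorem additionally assumes that no contract has agent 0 as its only participant; without this the claim fails (N={0}, one contract e with P(e)={0}, all choice functions the identity: {e_1,e_2} is stable but π is not injective on it). *)

(* Defs.v *)
From mathcomp Require Import all_boot.

Set Implicit Arguments.
Unset Strict Implicit.
Unset Printing Implicit Defensive.

(* A map 2^X -> 2^X, for X a subset of T, is represented by a function
   [{set T} -> {set T}]; only its values on subsets of X are constrained by the
   predicates below, and it is never applied to any other set. *)
Section ChoiceFunctions.
Variables (T : finType) (X : {set T}).
Implicit Types (A B : {set T}) (C F G : {set T} -> {set T}).

Definition choice_function C : Prop :=
  forall A, A \subset X -> C A \subset A.

Definition consistent C : Prop :=
  forall A B, A \subset X -> C A \subset B -> B \subset A -> C B = C A.

Definition substitutable C : Prop :=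
  forall A B, A \subset X -> B \subset A -> C A :&: B \subset C B.

Definition plott C : Prop :=
  [/\ choice_function C, consistent C & substitutable C].

Definition cf_star F G A : {set T} := F A :|: G (A :\: F A).

End ChoiceFunctions.

Record problem_data := ProblemData {
  agent : finType;
  contract : finType;
  part : contract -> {set agent};
  cf : agent -> {set contract} -> {set contract}
}.

Definition contracts_of (I : problem_data) (a : agent I) : {set contract I} :=
  [set e | a \in part e].

Definition is_problem (I : problem_data) : Prop :=
  forall a : agent I, plott (contracts_of a) (cf a).

Definition stable (I : problem_data) (S : {set contract I}) : Prop :=
  (forall a : agent I, cf a (S :&: contracts_of a) = S :&: contracts_of a) /\
  (forall e : contract I,
     (forall a, a \in part e -> e \in cf a ((S :&: contracts_of a) :|: [set e])) ->
     e \in S).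

Section ModifiedProblem.
Variables (I : problem_data) (a0 : agent I).
Variables C1 C2 : {set contract I} -> {set contract I}.

Definition other_agent : finType := {m : agent I | m != a0}.
Definition rest_contract : finType := {e : contract I | e \notin contracts_of a0}.
Definition split_contract : finType := {e : contract I | e \in contracts_of a0}.

(* The indices 1 and 2 are encoded by [false] and [true] respectively. *)
Definition mod_agent : finType := (bool + other_agent)%type.
Definition mod_contract : finType := (rest_contract + bool * split_contract)%type.

Definition proj (x : mod_contract) : contract I :=
  match x with
  | inl r => val r
  | inr (_, e) => val e
  end.

(* Agent [a0] is dropped from the participants: [m] ranges over agents other
   than [a0]. *)
Definition mod_part (x : mod_contract) : {set mod_agent} :=
  match x with
  | inl r => [set inr m | m : other_agent & val m \in part (val r)]
  | inr (i, e) => inl i |: [set inr m | m : other_agent & val m \in part (val e)]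
  end.

(* In each fibre of [proj] over a contract of [a0], the agents other than the
   two halves of [a0] take copy 1 if it is offered and copy 2 otherwise. *)
Definition mod_cf (a : mod_agent) (B : {set mod_contract}) : {set mod_contract} :=
  match a with
  | inl i =>
      [set inr (i, e) | e : split_contract
                      & val e \in (if i then C2 else C1) (proj @: B)]
  | inr m =>
      [set x | (proj x \in cf (val m) (proj @: B)) &&
               match x with
               | inl _ => true
               | inr (false, e) => inr (false, e) \in B
               | inr (true, e) => inr (false, e) \notin B
               end]
  end.

Definition modified : problem_data :=
  {| agent := mod_agent; contract := mod_contract;
     part := mod_part; cf := mod_cf |}.

End ModifiedProblem.

Arguments proj {I} a0 x.
Arguments modified {I} a0 C1 C2.

Definition set_bijection (T U : finType) (f : T -> U)
    (A : {set T}) (B : {set U}) : Prop :=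
  [/\ {in A, forall x, f x \in B},
      {in A &, injective f}
    & {in B, forall y, exists2 x, x \in A & f x = y}].

(* Main.v *)
Require Import Defs.
From mathcomp Require Import all_boot.

(** Every contract of [a0] has a participant other than [a0], who keeps at most
    one copy of it; this gives the bijection. Let [S1], [S2] be the contracts
    whose first, resp. second, copy lies in [St]. Stability of [St] against the
    first copies of contracts in [S2] forces [C1 (S1 :|: S2) = S1], so that
    [C1 * C2] chooses all of [S1 :|: S2]. If [e] blocks [proj a0 @: St] and
    involves [a0], then either [C1] accepts [e] and copy 1 of [e] blocks [St],
    or [C1] still chooses [S1], [C2] accepts [e] on top of [S2], and copy 2
    blocks [St]. *)

Set Implicit Arguments.
Unset Strict Implicit.
Unset Printing Implicit Defensive.

Lemma plott_accept_sub (T : finType) (X A B : {set T}) C (e : T) :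
  plott X C -> A \subset X -> B \subset A -> e \in B -> e \in C A -> e \in C B.
Proof.
by case=> _ _ subC AX BA eB eCA; apply: (subsetP (subC A B AX BA)); rewrite inE eCA.
Qed.

(** * Projection of the modified problem onto the original one *)

Section Modified.
Variables (I : problem_data) (a0 : agent I).
Variables C1 C2 : {set contract I} -> {set contract I}.
Notation mI := (modified a0 C1 C2).
Notation pi := (proj a0).
Implicit Types (B : {set contract mI}) (x : contract mI).
Implicit Types (m : other_agent a0) (e : split_contract a0).

Definition copy (i : bool) e : contract mI := inr (i, e).

(** Written as an image so that it is literally the set [mod_cf] passes to [C1] or [C2] for agent
    [inl i]. *)
Definition half B (i : bool) : {set contract I} :=
  pi @: (B :&: @contracts_of mI (inl i)).

Lemma in_contracts_other x m :
  (x \in @contracts_of mI (inr m)) = (val m \in part (pi x)).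
Proof.
rewrite inE; case: x => [r|[i e]] /=.
  by rewrite mem_imset ?inE // => ? ? [].
by rewrite !inE /= mem_imset ?inE // => ? ? [].
Qed.

Lemma in_contracts_half x (i : bool) :
  reflect (exists e, x = copy i e) (x \in @contracts_of mI (inl i)).
Proof.
rewrite inE; case: x => [r|[j e]] /=.
  by apply: (iffP imsetP) => [[]|[]].
rewrite !inE; apply: (iffP orP) => [[/eqP[->]|/imsetP[]//]|[e' [-> _]]].
  by exists e.
by left.
Qed.

Lemma proj_contracts_other B m :
  pi @: (B :&: @contracts_of mI (inr m)) = pi @: B :&: contracts_of (val m).
Proof.
apply/setP=> e; rewrite !inE; apply/imsetP/andP.
  by case=> x /setIP[xB]; rewrite in_contracts_other => xm ->; rewrite imset_f.
by case=> /imsetP[x xB ->] xm; exists x; rewrite // inE xB in_contracts_other.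
Qed.

Lemma mem_half B i e : (val e \in half B i) = (copy i e \in B).
Proof.
apply/imsetP/idP => [[x /setIP[xB /in_contracts_half[e' Dx]]]|eB].
  by rewrite Dx /= in xB * => /val_inj ->.
by exists (copy i e) => //; rewrite inE eB; apply/in_contracts_half; exists e.
Qed.

Lemma half_sub B i : half B i \subset contracts_of a0.
Proof.
by apply/subsetP=> y /imsetP[x /setIP[_ /in_contracts_half[e ->]] ->]; exact: (valP e).
Qed.

Lemma proj_contracts_split B :
  pi @: B :&: contracts_of a0 = half B false :|: half B true.
Proof.
apply/setP=> y; rewrite in_setI in_setU; apply/andP/idP.
  case=> /imsetP[[r|[i e]] xB ->] y0; first by case/negP: (valP r).
  have {}xB : copy i e \in B := xB.
  by rewrite !(mem_half B _ e); case: i xB {y0} => ->; rewrite ?orbT.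
move=> yh; have y0: y \in contracts_of a0.
  by case/orP: yh; apply/subsetP/half_sub.
split=> //; move: yh; rewrite -(SubK (split_contract a0) y0) !mem_half.
by case/orP=> xB; apply/imsetP; eexists; [exact: xB| |exact: xB|].
Qed.

(** * Consequences of stability of [St] *)

Section Stable.
Variable St : {set contract mI}.
Hypothesis hSt : stable St.
Notation S := (pi @: St).

Lemma other_chooses x m : x \in St -> val m \in part (pi x) ->
  x \in mod_cf C1 C2 (inr m) (St :&: @contracts_of mI (inr m)).
Proof.
move=> xS xm; have /= -> := hSt.1 (inr m).
by rewrite inE xS in_contracts_other.
Qed.

(** [mod_cf] chooses a copy only if its projection is chosen by [cf (val m)], and by stability every
    copy held is chosen. *)
Lemma other_cf m : choice_function (contracts_of (val m)) (cf (val m)) ->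
  cf (val m) (S :&: contracts_of (val m)) = S :&: contracts_of (val m).
Proof.
move=> cfm; apply/eqP; rewrite eqEsubset cfm ?subsetIr //=.
apply/subsetP=> y /setIP[/imsetP[x xS ->]]; rewrite inE => xm.
have := other_chooses xS xm.
by rewrite inE proj_contracts_other => /andP[].
Qed.

(** The equation of agent [inl i] only sees contracts of [a0]; the hypothesis excludes all
    others. *)
Lemma half_cf i : (if i then C2 else C1) (half St i) \subset contracts_of a0 ->
  (if i then C2 else C1) (half St i) = half St i.
Proof.
move=> sub0; have /= Di := hSt.1 (inl i).
have memi e : (val e \in (if i then C2 else C1) (half St i)) = (val e \in half St i).
  rewrite mem_half.
  have <-: (copy i e \in St :&: @contracts_of mI (inl i)) = (copy i e \in St).
    by rewrite in_setI andb_idr // => _; apply/in_contracts_half; exists e.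
  by rewrite -Di mem_imset ?inE // => ? ? [].
apply/setP=> y; case: (boolP (y \in contracts_of a0)) => y0.
  by rewrite -(SubK (split_contract a0) y0) memi.
have notin (Y : {set contract I}) : Y \subset contracts_of a0 -> (y \in Y) = false.
  by move=> Y0; apply: contraNF y0 => /(subsetP Y0).
by rewrite !notin ?half_sub.
Qed.

(** Under these acceptances copy [i] would block [St] if it were missing. The other participants
    take copy 2 only when copy 1 is absent, hence the condition for [i = true]. *)
Lemma copy_in_stable (i : bool) e :
    (i -> copy false e \notin St) ->
    val e \in (if i then C2 else C1) (half St i :|: [set val e]) ->
    (forall m, val m \in part (val e) ->
       val e \in cf (val m) (S :&: contracts_of (val m) :|: [set val e])) ->
  copy i e \in St.
Proof.
move=> free1 acc_i acc; apply: hSt.2 => -[j|m] e_a.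
  have: copy i e \in @contracts_of mI (inl j) by rewrite inE.
  case/in_contracts_half=> e1; rewrite /copy => -[<- _].
  by apply/imsetP; exists e => //; rewrite inE imsetU imset_set1.
have e_m: val m \in part (val e) by rewrite -(in_contracts_other (copy i e)) inE.
rewrite inE imsetU imset_set1 proj_contracts_other acc //=.
case: i free1 {acc_i e_a} => /= free1; rewrite !inE; last by rewrite eqxx orbT.
by rewrite (negPf (free1 isT)).
Qed.

Lemma proj_rest_in_stable (r : rest_contract a0) :
    (forall m, val m \in part (val r) ->
       val r \in cf (val m) (S :&: contracts_of (val m) :|: [set val r])) ->
  (inl r : contract mI) \in St.
Proof.
move=> acc; apply: hSt.2 => -[j|m] r_a; first by case/imsetP: r_a.
have r_m: val m \in part (val r) by rewrite -(in_contracts_other (inl r)) inE.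
by rewrite inE imsetU imset_set1 proj_contracts_other acc.
Qed.

Lemma proj_stable_inj : (forall e : contract I, part e <> [set a0]) ->
  {in St &, injective pi}.
Proof.
move=> hsolo; have not_both e : copy false e \in St -> copy true e \notin St.
  move=> e1; apply/negP=> e2.
  have [m em]: exists m, val m \in part (val e).
    case: (pickP [pred m | (m != a0) && (m \in part (val e))]) => [m /andP[m0 em]|none].
      by exists (Sub m m0).
    case: (hsolo (val e)); apply/setP=> m; rewrite inE.
    have := none m; rewrite /=; case: eqP => [-> _|_ /= ->] //.
    by have := valP e; rewrite inE.
  (* By stability [m] chooses copy 2, although copy 1 is on offer. *)
  have := other_chooses e2 em; rewrite inE => /andP[_].
  by rewrite inE [_ \in St]e1 in_contracts_other em.
move=> [r|[i e]] [r'|[i' e']] xS yS /= Exy.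
- by rewrite (val_inj Exy).
- by case/negP: (valP r); rewrite [val r]Exy (valP e').
- by case/negP: (valP r'); rewrite -[val r']Exy (valP e).
move: xS yS; rewrite -(val_inj Exy); case: i; case: i' => // xS yS.
  by have := not_both _ yS; rewrite [_ \in St]xS.
by have := not_both _ xS; rewrite [_ \in St]yS.
Qed.

End Stable.
End Modified.

Theorem theorem1 (I : problem_data) (hI : is_problem I) (a0 : agent I)
    (C1 C2 : {set contract I} -> {set contract I})
    (hC1 : plott (contracts_of a0) C1) (hC2 : plott (contracts_of a0) C2)
    (hC0 : forall A : {set contract I}, A \subset contracts_of a0 ->
       cf a0 A = cf_star C1 C2 A)
    (hsolo : forall e : contract I, part e <> [set a0])
    (St : {set contract (modified a0 C1 C2)})
    (hSt : stable St) :
  set_bijection (proj a0) St (proj a0 @: St) /\ stable (proj a0 @: St).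
Proof.
have inj := proj_stable_inj hSt hsolo.
split.
  split=> [x xS||y /imsetP[x xS ->]]; [exact: imset_f | exact: inj | by exists x].
set S := proj a0 @: St; set S1 := half St false; set S2 := half St true.
have S0E : S :&: contracts_of a0 = S1 :|: S2 by exact: proj_contracts_split.
have S10 : S1 \subset contracts_of a0 by exact: half_sub.
have S20 : S2 \subset contracts_of a0 by exact: half_sub.
have S120 : S1 :|: S2 \subset contracts_of a0 by rewrite subUset S10.
have [[cf1 con1 _] [cf2 _ _]] := (hC1, hC2).
have C1S1 : C1 S1 = S1.
  by apply: (half_cf hSt (i := false)); apply: subset_trans (cf1 _ S10) S10.
have C2S2 : C2 S2 = S2.
  by apply: (half_cf hSt (i := true)); apply: subset_trans (cf2 _ S20) S20.
have CmS (m : other_agent a0) :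
    cf (val m) (S :&: contracts_of (val m)) = S :&: contracts_of (val m).
  by apply: (other_cf hSt); case: (hI (val m)).
have disj e : e \in S1 -> e \notin S2.
  move=> e1; have e0 := subsetP S10 _ e1; apply/negP; move: e1.
  rewrite -(SubK (split_contract a0) e0) !mem_half => e1 e2.
  by have := inj _ _ e1 e2 erefl.
have C1S : C1 (S1 :|: S2) = S1.
  (* By consistency it is enough that [C1] picks nothing outside [S1]. An [e] in [S2] picked from
     the union is, by substitutability, also picked from [S1 :|: [set e]]. *)
  rewrite -{2}C1S1; apply/esym/con1; rewrite ?subsetUl //.
  apply/subsetP=> e eC; have := subsetP (cf1 _ S120) _ eC.
  case/setUP=> // e2; have e0 := subsetP S20 _ e2.
  rewrite -(SubK (split_contract a0) e0) mem_half.
  apply: (copy_in_stable hSt) => // [|m em]; rewrite SubK.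
    apply: (plott_accept_sub hC1 S120 _ _ eC); first by rewrite setUS ?sub1set.
    by rewrite !inE eqxx orbT.
  (* The other participants already hold [e], so adding it changes nothing for them. *)
  have eSm : e \in S :&: contracts_of (val m).
    rewrite SubK in em; rewrite in_setI (_ : e \in S) ?inE ?em //.
    by apply: (subsetP (subsetIl S (contracts_of a0))); rewrite S0E in_setU e2 orbT.
  by rewrite (setUidPl _) ?sub1set // CmS.
split=> [a|e acc].
  have [->|a_neq0] := eqVneq a a0; last exact: (CmS (Sub a a_neq0)).
  (* [C1] takes [S1] and by disjointness leaves exactly [S2] to [C2]. *)
  rewrite S0E hC0 // /cf_star C1S; suff -> : (S1 :|: S2) :\: S1 = S2 by rewrite C2S2.
  rewrite setDUl setDv set0U; apply/setDidPl; rewrite disjoint_sym.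
  by apply/pred0P=> e /=; apply/negP=> /andP[/disj/negPf->].
have accm (m : other_agent a0) : val m \in part e ->
    e \in cf (val m) (S :&: contracts_of (val m) :|: [set e]) by exact: acc.
have [e0|eR] := boolP (e \in contracts_of a0); last first.
  (* Without [a0], the contract has a single copy, which would itself block [St]. *)
  have rS: (inl (Sub e eR) : contract (modified a0 C1 C2)) \in St.
    by apply: (proj_rest_in_stable hSt).
  by rewrite -(SubK (rest_contract a0) eR); apply: (imset_f (proj a0) rS).
have [//|eS] := boolP (e \in S).
pose e' : split_contract a0 := Sub e e0.
suff [i eSt] : exists i, copy C1 C2 i e' \in St.
  by case/negP: eS; apply: (imset_f (proj a0) eSt).
have no_copy i : copy C1 C2 i e' \notin St.
  by apply: contra eS; apply: (imset_f (proj a0)).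
set A := S1 :|: S2 :|: [set e].
have A0 : A \subset contracts_of a0 by rewrite subUset S120 sub1set.
have a0e : a0 \in part e by have := e0; rewrite inE.
have := acc a0 a0e; rewrite S0E -/A hC0 // => /setUP[eC1|eC2].
  exists false; apply: (copy_in_stable hSt) => //.
  apply: (plott_accept_sub hC1 A0) => //; last by rewrite !inE eqxx orbT.
  by rewrite setSU ?subsetUl.
exists true; apply: (copy_in_stable hSt) => //.
have AC1 : A :\: C1 A \subset A by rewrite subsetDl.
have AC10 := subset_trans AC1 A0.
have : e \in A :\: C1 A by exact: (subsetP (cf2 _ AC10)).
rewrite inE => /andP[eC1 eA].
(* [C1] rejects [e], so [C1 A] lies in [S1 :|: S2] and consistency gives the value [C1S]. *)
have C1A : C1 A = S1.
  rewrite -C1S; apply/esym/con1; rewrite ?subsetUl //.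
  apply/subsetP=> x xC; have := subsetP (cf1 _ A0) _ xC.
  by case/setUP=> // /set1P xe; rewrite -xe xC in eC1.
apply: (plott_accept_sub hC2 AC10) => //; last by rewrite !inE eqxx orbT.
(* [S2] and [e] both survive the removal of [C1 A = S1], so substitutability of [C2] applies. *)
rewrite C1A in eC1 *; apply/subsetP=> x /setUP[x2|/set1P->]; last by rewrite inE eC1.
rewrite !inE [x \in S2]x2 orbT andbT; by apply/negP=> /disj; rewrite [x \in S2]x2.
Qed.
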